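(* Let $G=(V,E)$ be a graph and $d=(d_v)_{v\in V}$ with integers $d_v\ge2$. If $G$ is reducible into $G_1=(V_1,E_1)$ and $G_2=(V_2,E_2)$ and if both $(G_1,(d_v)_{v\in V_1})$ and $(G_2,(d_v)_{v\in V_2})$ have the positive margins property, then $(G,d)$ also has the positive margins property.
   Context: Graphs are finite, simple, undirected. $G=(V,E)$ is reducible into $G_1,G_2$ if $V_1,V_2\subsetneq V$ are proper subsets such that $V_1\cap V_2$ is a clique of $G$, $G_1$ and $G_2$ are the subgraphs of $G$ induced on $V_1$ and $V_2$, and $G$ is the union of $G_1$ and $G_2$ (both vertices and edges). For a graph $G=(V,E)$ and $d$, let $\mathcal X=\prod_{v\in V}[d_v]$, $[m]=\{1,\dots,m\}$, $x_W=(x_v)_{v\in W}$. $\mathcal B_{\mathrm{gl}(G)}\subset\mathbb Z^{\mathcal X}$ is the set of all moves $e_{x_Ax_Bx_C}+e_{x'_Ax'_Bx_C}-e_{x_Ax'_Bx_C}-e_{x'_Ax_Bx_C}$ ($e_x$ = unit vectors), where $A,B,C$ range over all partitions $V=A\cup B\cup C$ into disjoint (possibly empty) sets such that every path in $G$ from a vertex of $A$ to a vertex of $B$ meets $C$, and $x_A,x'_A,x_B,x'_B,x_C$ range over all states of the respective subsets. $A_G$ is the integer matrix with $(A_Gu)_{W,y}=\sum_{x\in\mathcal X:\,x_W=y}u_x$ for every clique $W$ of $G$ and $y\in\prod_{v\in W}[d_v]$. The fiber of $u\in\mathbb N^{\mathcal X}$ is $\{v\in\mathbb N^{\mathcal X}:A_Gv=A_Gu\}$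 ($0\in\mathbb N$). It is connected by $\mathcal B_{\mathrm{gl}(G)}$ if any two of its elements are joined by a finite sequence in $\mathbb N^{\mathcal X}$ whose consecutive differences lie in $\pm\mathcal B_{\mathrm{gl}(G)}$. $(G,d)$ has the positive margins property if, for every $u\in\mathbb N^{\mathcal X}$ such that all entries of $A_Gu$ are strictly positive, the fiber of $u$ is connected by $\mathcal B_{\mathrm{gl}(G)}$. *)

(* Defs.v *)
From HB Require Import structures.
From mathcomp Require Import all_boot all_order all_algebra.

Set Implicit Arguments.
Unset Strict Implicit.
Unset Printing Implicit Defensive.

Import GRing.Theory.
Local Open Scope ring_scope.

(* A graph on V is a symmetric irreflexive relation e : rel V.  The subgraph
   induced on W : {set V} has vertex type {v : V | v \in W}. *)

Definition clique (V : finType) (e : rel V) (W : {set V}) : Prop :=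
  {in W &, forall x y, x != y -> e x y}.

Definition induced (V : finType) (e : rel V) (W : {set V}) :
  rel {v : V | v \in W} := relpre val e.

Definition reducible_into (V : finType) (e : rel V) (V1 V2 : {set V}) : Prop :=
  [/\ V1 \proper [set: V], V2 \proper [set: V], clique e (V1 :&: V2),
      V1 :|: V2 = [set: V]
    & forall x y, e x y ->
        (x \in V1) && (y \in V1) || (x \in V2) && (y \in V2)].

Definition separates (V : finType) (e : rel V) (A B C : {set V}) : Prop :=
  forall (a : V) (p : seq V), a \in A -> last a p \in B ->
    path e a p -> uniq (a :: p) -> has [in C] (a :: p).

Definition restr_card (V : finType) (d : V -> nat) (W : {set V}) :
  {v : V | v \in W} -> nat := fun v => d (val v).

(* The label set {1, ..., d_v} is encoded as 'I_(d v) = {0, ..., d_v - 1}. *)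
Definition state (V : finType) (d : V -> nat) : finType :=
  {dffun forall v : V, 'I_(d v)}.

Definition restr (V : finType) (d : V -> nat) (W : {set V}) (x : state d) :
  state (restr_card d (W := W)) :=
  [ffun v : {v : V | v \in W} => (x (val v) : 'I_(restr_card d v))].

Definition table (V : finType) (d : V -> nat) := {ffun state d -> nat}.

(* The entry of A_G u indexed by (W, y). *)
Definition margin (V : finType) (d : V -> nat) (u : table d) (W : {set V})
  (y : state (restr_card d (W := W))) : nat :=
  (\sum_(x : state d | restr W x == y) u x)%N.

Definition in_fiber (V : finType) (e : rel V) (d : V -> nat)
  (u v : table d) : Prop :=
  forall W : {set V}, clique e W ->
    forall y : state (restr_card d (W := W)), margin v y = margin u y.

Definition unit_vec (V : finType) (d : V -> nat) (x : state d) :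
  {ffun state d -> int} := [ffun y => (y == x)%:R].

(* The state (x_A, y_B, z_C), where C is the complement of A :|: B. *)
Definition glue (V : finType) (d : V -> nat) (A B : {set V})
  (x y z : state d) : state d :=
  [ffun v : V => (if v \in A then x v else if v \in B then y v else z v
                  : 'I_(d v))].

(* The states of A, B and C are given as the restrictions of two full states
   x and x'; this loses nothing, since x_A, x_B, x_C (and likewise x'_A, x'_B)
   are then arbitrary and independent of each other. *)
Definition markov_move (V : finType) (e : rel V) (d : V -> nat)
  (m : {ffun state d -> int}) : Prop :=
  exists A B C : {set V},
    [/\ [disjoint A & B], [disjoint A & C], [disjoint B & C],
        A :|: B :|: C = [set: V] & separates e A B C] /\
    exists x x' : state d,
      m = unit_vec (glue A B x x x) + unit_vec (glue A B x' x' x)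
          - unit_vec (glue A B x x' x) - unit_vec (glue A B x' x x).

Definition diff (V : finType) (d : V -> nat) (v w : table d) :
  {ffun state d -> int} := [ffun x => (w x)%:Z - (v x)%:Z].

Definition markov_step (V : finType) (e : rel V) (d : V -> nat)
  (v w : table d) : Prop :=
  markov_move e (diff v w) \/ markov_move e (- diff v w).

Definition joined (V : finType) (e : rel V) (d : V -> nat)
  (v w : table d) : Prop :=
  exists (n : nat) (s : nat -> table d),
    [/\ s 0%N = v, s n = w
      & forall i : nat, (i < n)%N -> markov_step e (s i) (s i.+1)].

Definition positive_margins (V : finType) (e : rel V) (d : V -> nat) : Prop :=
  forall u : table d,
    (forall W : {set V}, clique e W ->
       forall y : state (restr_card d (W := W)), (0 < margin u y)%N) ->
    forall v w : table d, in_fiber e u v -> in_fiber e u w -> joined e v w.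

(* Main.v *)
Require Import Defs.
From mathcomp Require Import all_boot all_order all_algebra.
From mathcomp Require Import zify.

Set Implicit Arguments.
Unset Strict Implicit.
Unset Printing Implicit Defensive.

(** Let S = V1 :&: V2.  A move of the V1-marginal cannot have sites of the
    clique S on both sides of its partition; adding V2 \ V1 to a side whose
    complementary side misses S lifts it to a move on V that fixes the
    V2-marginal.  Lifting a path for G1 and then one for G2 produces a table
    with the same V1- and V2-marginals as the target.  Two such tables are
    connected by moves separating V1 \ V2 from V2 \ V1, each of which decreases
    their L1-distance. *)

(** * Moves as exchanges between two states *)

Definition cross (V : finType) (d : V -> nat) (A : {set V}) (x y : state d) :
  state d := [ffun v : V => (if v \in A then x v else y v : 'I_(d v))].

(** Additions on both sides avoid truncated subtraction: [x] and [y] leave the table, [x'] and [y']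
    enter. *)
Definition exchanged (V : finType) (d : V -> nat) (v w : table d)
  (x y x' y' : state d) : Prop :=
  forall z, w z + (z == x) + (z == y) = v z + (z == x') + (z == y').

Definition crossable (V : finType) (e : rel V) (d : V -> nat) (A : {set V})
  (x y : state d) : Prop :=
  forall a b, a \in A -> b \notin A -> e a b -> (x a == y a) || (x b == y b).

(* On the sites where two states agree it does not matter on which side of the
   partition the site lies, so a move is given by two states and a set A such
   that no edge leaving A joins two sites of disagreement. *)
Definition swap_step (V : finType) (e : rel V) (d : V -> nat) (v w : table d) :
  Prop := exists A x y,
    crossable e A x y /\ exchanged v w x y (cross A x y) (cross A y x).

Section States.

Variables (V : finType) (e : rel V) (d : V -> nat).
Implicit Types (v w : table d) (x y z : state d) (A B C W : {set V}).

Lemma restr_eqP W x y :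
  reflect {in W, forall i, x i = y i} (restr W x == restr W y).
Proof.
apply: (iffP eqP) => [/ffunP E i iW | E].
  by have := E (Sub i iW); rewrite !ffunE.
by apply/ffunP => i; rewrite !ffunE; exact: E (valP i).
Qed.

Lemma restr_surj W (y : state (restr_card d (W := W))) :
  (forall i, 0 < d i) -> exists x, restr W x = y.
Proof.
move=> d_gt0.
(* [decP] hands the membership proof to [y]; outside [W] the label defaults to 0. *)
pose f i : 'I_(d i) := match decP (@idP (i \in W)) with
  | left iW => y (exist _ i iW)
  | right _ => Ordinal (d_gt0 i)
  end.
exists [ffun i => f i]; apply/ffunP => -[i iW]; rewrite !ffunE /= /f.
by case: decP => // iW'; rewrite (bool_irrelevance iW iW').
Qed.

Lemma crossK A x y : cross A (cross A x y) (cross A y x) = x.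
Proof. by apply/ffunP => i; rewrite !ffunE; case: ifP => ->. Qed.

Lemma crossC A x y : cross (~: A) x y = cross A y x.
Proof. by apply/ffunP => i; rewrite !ffunE inE; case: (i \in A). Qed.

Lemma cross_id A x : cross A x x = x.
Proof. by apply/ffunP => i; rewrite ffunE; case: ifP. Qed.

Lemma separates_edge A B C : [disjoint A & B] -> [disjoint A & C] ->
  [disjoint B & C] -> separates e A B C ->
  forall a b, a \in A -> b \in B -> ~~ e a b.
Proof.
move=> AB AC BC sep a b aA bB; apply/negP => eab.
have := sep a [:: b] aA bB; rewrite /= eab inE andbT orbF.
have -> : a != b.
  by apply: contraTneq aA => ->; rewrite (disjointFl AB).
by rewrite (disjointFr AC aA) (disjointFr BC bB) => /(_ isT isT).
Qed.

(** As the three sets cover [V], a path that leaves [A] must step into [C] first. *)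
Lemma edgeless_separates A B C : A :|: B :|: C = [set: V] ->
  [disjoint A & B] ->
  (forall a b, a \in A -> b \in B -> ~~ e a b) -> separates e A B C.
Proof.
move=> ABC AB noe a p; elim: p a => [|b p IHp] a aA /=.
  by rewrite (disjointFr AB aA).
move=> bB /andP[eab pb] /andP[_ up].
have : b \in A :|: B :|: C by rewrite ABC inE.
rewrite !inE => /orP[/orP[bA|bB']|bC]; last by rewrite bC orbT.
  by apply/orP; right; exact: IHp.
by have := noe _ _ aA bB'; rewrite eab.
Qed.

Lemma exchanged_sym v w x y x' y' :
  exchanged v w x y x' y' -> exchanged w v x' y' x y.
Proof. by move=> E z; rewrite E. Qed.

Lemma exchanged_inj v w w' x y x' y' :
  exchanged v w x y x' y' -> exchanged v w' x y x' y' -> w = w'.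
Proof. by move=> E E'; apply/ffunP => z; move: (E z) (E' z); lia. Qed.

Lemma exchanged_refl v x y : exchanged v v x y x y.
Proof. by []. Qed.

Lemma exchanged_swap v x y : exchanged v v x y y x.
Proof. by move=> z; rewrite addnAC. Qed.

Lemma swap_step_sym v w : swap_step e v w -> swap_step e w v.
Proof.
move=> [A [x [y [ok E]]]]; exists A, (cross A x y), (cross A y x).
split; last by rewrite !crossK; exact: exchanged_sym.
move=> a b aA bA eab; rewrite !ffunE aA (negPf bA) [y b == _]eq_sym.
exact: ok.
Qed.

Lemma swap_stepC v w A x y : symmetric e -> crossable e A x y ->
  exchanged v w x y (cross A x y) (cross A y x) ->
  crossable e (~: A) x y /\
  exchanged v w x y (cross (~: A) x y) (cross (~: A) y x).
Proof.
move=> e_sym ok E; split=> [a b|z].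
  rewrite !inE negbK orbC => aA bA; rewrite e_sym => eba; exact: ok.
by rewrite !crossC E addnAC.
Qed.

(** As [x] and [y] differ, a single copy of each suffices for the subtractions to be exact. *)
Lemma exchanged_exists v x y x' y' : x != y -> 0 < v x -> 0 < v y ->
  exists w, exchanged v w x y x' y'.
Proof.
move=> xy vx vy.
exists [ffun z => v z + (z == x') + (z == y') - (z == x) - (z == y)] => z.
rewrite ffunE; case: (eqVneq z x) => [->|_]; first by rewrite (negPf xy); lia.
by case: (eqVneq z y) => [->|_]; lia.
Qed.

Lemma markov_move_swap v w : markov_move e (diff v w) -> swap_step e v w.
Proof.
move=> [A [B [C [[AB AC BC ABC sep] [x [x' E]]]]]].
(* The positive terms of the move enter on the way to [w], so they are the states that leave on the
   way back. They agree on [C], and no edge joins [A] to [B]. *)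
apply: swap_step_sym; exists A, x, (glue A B x' x' x).
have noe := separates_edge AB AC BC sep.
split=> [a b aA bA|z].
  rewrite !ffunE aA (negPf bA); case: ifP => [bB|_]; last by rewrite eqxx orbT.
  by rewrite (negPf (noe _ _ aA bB)).
have {1}-> : x = glue A B x x x.
  by apply/ffunP => i; rewrite ffunE; do 2?case: ifP.
have -> : cross A x (glue A B x' x' x) = glue A B x x' x.
  by apply/ffunP => i; rewrite !ffunE; case: (i \in A); case: (i \in B).
have -> : cross A (glue A B x' x' x) x = glue A B x' x x.
  by apply/ffunP => i; rewrite !ffunE; case: (i \in A); case: (i \in B).
move/ffunP: E => /(_ z); rewrite !ffunE.
case: (z == glue A B x x x); case: (z == glue A B x' x' x);
case: (z == glue A B x x' x); case: (z == glue A B x' x x); lia.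
Qed.

Lemma markov_step_swap v w : markov_step e v w -> swap_step e v w.
Proof.
case=> [|mv]; first exact: markov_move_swap.
apply/swap_step_sym/markov_move_swap; suff <- : (- diff v w)%R = diff w v by [].
by apply/ffunP => z; rewrite !ffunE GRing.opprB.
Qed.

Lemma swap_markov_step v w : swap_step e v w -> markov_step e v w.
Proof.
move=> [A [x [y [ok E]]]]; right.
(* The sites of agreement serve as separator. The states [x], [y] leave, so they are the positive
   terms of [- diff v w]. *)
pose D := [set i | x i != y i].
have AB : [disjoint A :&: D & D :\: A].
  rewrite -setI_eq0; apply/eqP/setP => i; rewrite !inE.
  by case: (i \in A); rewrite ?andbF.
exists (A :&: D), (D :\: A), (~: D); split.
  have dC (X Y : {set V}) : X \subset Y -> [disjoint X & ~: Y].
    by rewrite -setI_eq0 -setDE setD_eq0.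
  have ABC : A :&: D :|: (D :\: A) :|: ~: D = [set: V].
    by apply/setP => i; rewrite !inE; case: (i \in A); case: (x i == y i).
  split=> //; first exact/dC/subsetIr; first exact/dC/subsetDl.
  apply: edgeless_separates => // a b; rewrite !inE.
  move=> /andP[aA xya] /andP[bA xyb].
  by apply/negP => /(ok _ _ aA bA); rewrite (negPf xya) (negPf xyb).
exists x, y.
have gE x1 x2 : x1 = x \/ x1 = y -> x2 = x \/ x2 = y ->
    glue (A :&: D) (D :\: A) x1 x2 x = cross A x1 x2.
  by case=> ->; case=> ->; apply/ffunP => i; rewrite !ffunE !inE;
    case: (i \in A); case: (x i =P y i).
rewrite !gE; auto; rewrite !cross_id; apply/ffunP => z; rewrite !ffunE.
by move: (E z); case: (z == x); case: (z == y);
  case: (z == cross A x y); case: (z == cross A y x); lia.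
Qed.

(** * Paths of moves *)

Lemma joined_refl v : joined e v v.
Proof. by exists 0, (fun=> v). Qed.

Lemma joined_step v w : markov_step e v w -> joined e v w.
Proof.
by move=> vw; exists 1, (fun i => if i is 0 then v else w); split=> // -[].
Qed.

Lemma joined_trans u v w : joined e u v -> joined e v w -> joined e u w.
Proof.
move=> [m [s [s0 sm Hs]]] [n [t [t0 tn Ht]]].
exists (m + n), (fun i => if i <= m then s i else t (i - m)).
split=> [|| i imn].
- by [].
- case: leqP => h; last by rewrite addKn.
  have n0 : n = 0 by lia.
  by rewrite n0 addn0 sm -tn n0.
(* The step lies in [s], in [t], or at the junction, where [s m] equals [t 0]. *)
case: (ltngtP i m) => im; first exact: Hs.
  by rewrite subSn ?(ltnW im) //; apply: Ht; lia.
by rewrite im sm -t0 subSn // subnn; apply: Ht; lia.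
Qed.

(** The first step of the path is peeled off, so the end [w] stays fixed. *)
Lemma joined_ind (P : table d -> Prop) w :
  P w -> (forall u v, markov_step e u v -> P v -> P u) ->
  forall v, joined e v w -> P v.
Proof.
move=> Pw IH v [n [s [<- sn Hs]]].
elim: n s sn Hs => [|n IHn] s sn Hs; first by rewrite sn.
apply: IH (Hs 0 _) _ => //; apply: (IHn (fun i => s i.+1)) => // i lin.
exact: Hs.
Qed.

End States.

(** * Marginal tables on a set of vertices *)

Definition marginal (V : finType) (d : V -> nat) (W : {set V}) (u : table d) :
  table (restr_card d (W := W)) := [ffun y => margin u y].

Lemma reducible_into_sym (V : finType) (e : rel V) (V1 V2 : {set V}) :
  reducible_into e V1 V2 -> reducible_into e V2 V1.
Proof.
case=> p1 p2 cl cov ed; split=> //; rewrite 1?setIC 1?setUC //.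
by move=> x y /ed; rewrite orbC.
Qed.

Section Marginals.

Variables (V : finType) (e : rel V) (d : V -> nat).
Implicit Types (u v w : table d) (x y z : state d) (W : {set V}).

(** Summation in two stages: states of [V] are grouped by their restriction to [W]. *)
Lemma margin_marginal W (U : {set {i | i \in W}}) v x :
  margin (marginal W v) (restr U (restr W x)) =
  margin v (restr (val @: U) x).
Proof.
pose Q := [pred y : state (restr_card d (W := W)) |
  restr U y == restr U (restr W x)].
pose p : state d -> state (restr_card d (W := W)) := @restr V d W.
rewrite /margin [RHS](partition_big p Q) /=.
  apply: eq_bigr => y yx; rewrite ffunE; apply: eq_bigl => z.
  rewrite andbC; case: eqP => //= zy; rewrite -zy in yx.
  apply/esym/restr_eqP => _ /imsetP[i iU ->].
  by have /restr_eqP/(_ i iU) := yx; rewrite !ffunE.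
move=> z /restr_eqP zx; apply/restr_eqP => i iU; rewrite !ffunE.
exact/zx/imset_f.
Qed.

Lemma clique_imset W (U : {set {i | i \in W}}) :
  clique (induced e (W := W)) U -> clique e (val @: U).
Proof.
move=> cl _ _ /imsetP[i iU ->] /imsetP[j jU ->] ij.
by apply: (cl i j) => //; apply: contraNneq ij => ->.
Qed.

Hypothesis d_gt0 : forall i, 0 < d i.

Lemma restr_restr_surj W (U : {set {i | i \in W}})
    (y : state (restr_card (restr_card d (W := W)) (W := U))) :
  exists x, restr U (restr W x) = y.
Proof.
have [y' <-] := restr_surj y (fun i => d_gt0 (val i)).
by have [x <-] := restr_surj y' d_gt0; exists x.
Qed.

(** Cliques of the induced subgraph are cliques of the whole graph, so their margins are already
    fixed. *)
Lemma in_fiber_marginal W u v : in_fiber e u v ->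
  in_fiber (induced e (W := W)) (marginal W u) (marginal W v).
Proof.
move=> uv U cl y; have [x <-] := restr_restr_surj y.
by rewrite !margin_marginal; apply/uv/clique_imset.
Qed.

Lemma positive_marginal W u :
  (forall U : {set V}, clique e U ->
    forall y : state (restr_card d (W := U)), 0 < margin u y) ->
  forall U, clique (induced e (W := W)) U ->
    forall y : state (restr_card (restr_card d (W := W)) (W := U)),
      0 < margin (marginal W u) y.
Proof.
move=> u_gt0 U cl y; have [x <-] := restr_restr_surj y.
by rewrite margin_marginal; apply/u_gt0/clique_imset.
Qed.

(** Marginalization is additive and sends the unit vector at [a] to the one at [restr W a]. *)
Lemma marginal_exchanged W v w x y x' y' : exchanged v w x y x' y' ->
  exchanged (marginal W v) (marginal W w)
    (restr W x) (restr W y) (restr W x') (restr W y').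
Proof.
have cnt (a : state d) (t : state (restr_card d (W := W))) :
    \sum_(z | restr W z == t) (z == a) = (t == restr W a).
  rewrite big_mkcond (bigD1 a) //= eqxx eq_sym big1 ?addn0; first by case: eqP.
  by move=> z /negPf ->; rewrite if_same.
move=> E t; rewrite !ffunE /margin -!cnt -!big_split /=.
by apply: eq_bigr => z _; exact: E.
Qed.

Lemma marginal_gt0 W v (x : state (restr_card d (W := W))) :
  0 < marginal W v x ->
  exists2 z, restr W z = x & 0 < v z.
Proof.
rewrite ffunE lt0n sum_nat_eq0 => /forallPn[z]; rewrite negb_imply.
by case/andP => /eqP zx; rewrite -lt0n; exists z.
Qed.

End Marginals.

(** * Lifting moves from an induced subgraph *)

Section Reducible.

Variables (V : finType) (e : rel V) (d : V -> nat) (V1 V2 : {set V}).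
Hypotheses (e_sym : symmetric e) (G_red : reducible_into e V1 V2).
Implicit Types (v w : table d) (x y z : state d).

Lemma swap_step_lift v (t : table (restr_card d (W := V1))) :
  swap_step (induced e (W := V1)) (marginal V1 v) t ->
  exists w, [/\ joined e v w, marginal V1 w = t
            & marginal V2 w = marginal V2 v].
Proof.
have [_ _ clS _ ed] := G_red.
move=> [A [x [y [ok E]]]].
(* Two sites of disagreement in the clique, on opposite sides of [A], would span an edge forbidden
   by [crossable]. So one side has no disagreement in the clique; complementing [A] if needed makes
   it the outside. *)
wlog SA : A ok E /
    forall i : {i | i \in V1}, val i \in V2 -> i \notin A -> x i = y i.
  move=> wl; have [SA|] := boolP [forall i : {i | i \in V1},
    (val i \in V2) ==> (i \notin A) ==> (x i == y i)].
    apply: (wl A) => // i i2 iA; apply/eqP.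
    by move/forallP/(_ i): SA; rewrite i2 iA.
  move=> /forallPn[i]; rewrite !negb_imply => /and3P[i2 iA xyi].
  have i_sym : symmetric (induced e (W := V1)) by move=> ? ?; exact: e_sym.
  have [ok' E'] := swap_stepC i_sym ok E; apply: (wl (~: A)) => // j j2.
  rewrite inE negbK => jA.
  apply/eqP; have := ok _ _ jA iA; rewrite (negPf xyi) orbF; apply.
  apply: (clS (val j) (val i)); rewrite ?inE ?(valP i) ?(valP j) //.
  by apply: contraNneq iA => /val_inj <-.
(* If crossing merely reproduces [x] and [y], nothing changes. Otherwise both really leave the
   marginal table, hence are positive there and extend to states [X], [Y] occurring in [v]. *)
have degen : t = marginal V1 v -> exists w,
    [/\ joined e v w, marginal V1 w = t & marginal V2 w = marginal V2 v].
  by move=> ->; exists v; split=> //; exact: joined_refl.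
have [xc|xc] := eqVneq x (cross A x y).
  have yc : y = cross A y x.
    apply/ffunP => i; move/ffunP/(_ i): xc; rewrite !ffunE.
    by case: (i \in A).
  apply/degen/(exchanged_inj E); rewrite -xc -yc; exact: exchanged_refl.
have [xc'|xc'] := eqVneq x (cross A y x).
  have yc : y = cross A x y.
    apply/ffunP => i; move/ffunP/(_ i): xc'; rewrite !ffunE.
    by case: (i \in A).
  apply/degen/(exchanged_inj E); rewrite -xc' -yc; exact: exchanged_swap.
have xy : x != y by apply: contraNneq xc => <-; rewrite cross_id.
have yc : y != cross A x y.
  apply: contraNneq xc' => yc; apply/eqP/ffunP => i; move/ffunP/(_ i): yc.
  by rewrite !ffunE; case: (i \in A).
have yc' : y != cross A y x.
  apply: contraNneq xc => yc1; apply/eqP/ffunP => i; move/ffunP/(_ i): yc1.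
  by rewrite !ffunE; case: (i \in A).
have vx : 0 < marginal V1 v x.
  by have := E x; rewrite eqxx (negPf xc) (negPf xc'); lia.
have vy : 0 < marginal V1 v y.
  by have := E y; rewrite eqxx (negPf yc) (negPf yc'); lia.
have [X Xx vX] := marginal_gt0 vx; have [Y Yy vY] := marginal_gt0 vy.
have XE i (i1 : i \in V1) : X i = x (Sub i i1) by rewrite -Xx ffunE.
have YE i (i1 : i \in V1) : Y i = y (Sub i i1) by rewrite -Yy ffunE.
(* With all of [V2] outside [V1] added to [A], the part of [V2] outside [B] lies in the clique,
   where [X] and [Y] agree. Thus crossing along [B] does not alter restrictions to [V2]. *)
pose B := (val @: A) :|: ~: V1.
have BvalE (i : {i | i \in V1}) : (val i \in B) = (i \in A).
  by rewrite !inE (valP i) orbF mem_imset //; exact: val_inj.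
have BE i (i1 : i \in V1) : (i \in B) = (Sub i i1 \in A) := BvalE (Sub i i1).
have S_agree i : i \in V2 -> i \notin B -> X i = Y i.
  move=> i2 iB; have i1 : i \in V1.
    by move: iB; rewrite !inE negb_or negbK => /andP[].
  by rewrite (XE i i1) (YE i i1); apply: (SA (Sub i i1)); rewrite -?BE.
have okB : crossable e B X Y.
  move=> a b aB bB eab.
  have b1 : b \in V1 by move: bB; rewrite !inE negb_or negbK => /andP[].
  have [a1|a1] := boolP (a \in V1).
    by rewrite (XE a a1) (YE a a1) (XE b b1) (YE b b1); apply: ok; rewrite -?BE.
  rewrite (S_agree b) ?eqxx ?orbT //.
  by move: (ed _ _ eab); rewrite (negPf a1) => /andP[].
have XY : X != Y by apply: contraNneq xy => XY; rewrite -Xx -Yy XY.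
have [w Ew] := exchanged_exists (cross B X Y) (cross B Y X) XY vX vY.
have restr1 (X1 Y1 : state d) :
    restr V1 (cross B X1 Y1) = cross A (restr V1 X1) (restr V1 Y1).
  by apply/ffunP => i; rewrite !ffunE BvalE.
exists w; split.
- by apply/joined_step/swap_markov_step => //; exists B, X, Y.
- have := marginal_exchanged (W := V1) Ew.
  by rewrite !restr1 Xx Yy => Et; exact: exchanged_inj Et E.
have restr2 (X1 Y1 : state d) : {in V2, forall i, i \notin B -> X1 i = Y1 i} ->
    restr V2 (cross B X1 Y1) = restr V2 X1.
  move=> XY1; apply/eqP/restr_eqP => i i2; rewrite ffunE.
  by case: ifPn => // iB; rewrite XY1.
apply: (exchanged_inj (marginal_exchanged (W := V2) Ew)).
rewrite !restr2 => [|i i2 iB|i i2 iB]; first exact: exchanged_refl.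
  by rewrite S_agree.
by rewrite S_agree.
Qed.

Lemma joined_lift v (t : table (restr_card d (W := V1))) :
  joined (induced e (W := V1)) (marginal V1 v) t ->
  exists w, [/\ joined e v w, marginal V1 w = t
            & marginal V2 w = marginal V2 v].
Proof.
(* Quantifying over every [v] above [u] lets the induction continue from the table produced by the
   previous lift. *)
pose P u := forall v, marginal V1 v = u -> exists w,
  [/\ joined e v w, marginal V1 w = t & marginal V2 w = marginal V2 v].
suff H u : joined (induced e (W := V1)) u t -> P u by move=> /H; exact.
apply: (joined_ind (P := P)) => {u v}.
  by move=> v vt; exists v; split=> //; exact: joined_refl.
move=> u1 u2 /markov_step_swap st IH v uE.
rewrite -uE in st; have [w [vw /IH[w' [ww' ? wE]] w2]] := swap_step_lift st.
by exists w'; split=> //; [exact: joined_trans ww' | rewrite wE].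
Qed.

(** * Connecting tables with equal marginals *)

Lemma eq_sum_ltn_exists (I : finType) (P : pred I) (f g : I -> nat) i :
  \sum_(j | P j) f j = \sum_(j | P j) g j -> P i -> f i < g i ->
  exists2 j, P j & g j < f j.
Proof.
move=> fg Pi lt_i; apply/exists_inP/contraT.
rewrite negb_exists_in => /forall_inP le_fg.
suff : \sum_(j | P j) f j < \sum_(j | P j) g j by rewrite fg ltnn.
rewrite (bigD1 i) // [ltnRHS](bigD1 i) //= -addSn leq_add // leq_sum // => j.
by case/andP => Pj _; rewrite leqNgt; exact: le_fg.
Qed.

Lemma joined_same_marginals v w :
  marginal V1 v = marginal V1 w -> marginal V2 v = marginal V2 w ->
  joined e v w.
Proof.
have [_ _ _ cov ed] := G_red.
have covE i : (i \in V1) || (i \in V2) by rewrite -in_setU cov inE.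
(* The measure is the total excess of [v] over [w], half their L1-distance since the totals
   agree. *)
have [n] := ubnP (\sum_z (v z - w z)); elim: n v => // n IHn v le_n vw1 vw2.
have mE W (z : state d) : marginal W v = marginal W w ->
    \sum_(x | restr W x == restr W z) v x =
    \sum_(x | restr W x == restr W z) w x.
  by move/ffunP/(_ (restr W z)); rewrite !ffunE.
have [->|] := eqVneq v w; first exact: joined_refl.
move=> vw; have [z0 lt0] : exists z, v z < w z.
  have : ~~ [forall z, v z == w z].
    by apply: contra vw => /forallP E; apply/eqP/ffunP => z; apply/eqP.
  case/forallPn => z; rewrite neq_ltn => /orP[|lt_z]; first by exists z.
  have [z1 _ ?] := eq_sum_ltn_exists (esym (mE V1 z vw1)) (eqxx _) lt_z.
  by exists z1.
(* The deficit of [v] at [z0] is balanced by an excess at some [x] equal to [z0] on [V1], and at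
   some [y] equal to [z0] on [V2]. Crossing [x] and [y] then produces [z0]. *)
have [x /restr_eqP xz wx] := eq_sum_ltn_exists (mE V1 z0 vw1) (eqxx _) lt0.
have [y /restr_eqP yz wy] := eq_sum_ltn_exists (mE V2 z0 vw2) (eqxx _) lt0.
have z0E : cross V1 x y = z0.
  apply/ffunP => i; rewrite ffunE; case: ifPn => i1; first exact: xz.
  by apply: yz; move: (covE i); rewrite (negPf i1).
have xy : x != y.
  by apply: contraTneq wx => xy; rewrite -z0E -xy cross_id in lt0; lia.
have ok : crossable e V1 x y.
  move=> a b a1 b1 /ed; rewrite (negPf b1) andbF => /= /andP[a2 _].
  by rewrite xz // yz // eqxx.
have [v' Ev] := exchanged_exists (cross V1 x y) (cross V1 y x)
  xy (leq_ltn_trans (leq0n _) wx) (leq_ltn_trans (leq0n _) wy).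
have r1 (a b : state d) : restr V1 (cross V1 a b) = restr V1 a.
  by apply/eqP/restr_eqP => i i1; rewrite ffunE i1.
have r20 : restr V2 z0 = restr V2 y.
  by apply/esym/eqP/restr_eqP => i i2; exact: yz.
have r2 : restr V2 (cross V1 y x) = restr V2 x.
  apply/eqP/restr_eqP => i i2; rewrite ffunE; case: ifP => // i1.
  by rewrite xz // yz.
apply: (joined_trans (v := v')).
  by apply/joined_step/swap_markov_step => //; exists V1, x, y.
apply: IHn.
- have cnt (a : state d) : \sum_z (z == a) = 1.
    by rewrite (bigD1 a) //= eqxx big1 // => z /negPf ->.
  (* Losing [x] and [y] lowers the excess by 2, gaining [z0] costs nothing, and gaining the other
     crossed state costs at most 1. *)
  suff : \sum_z (v' z - w z + (z == x) + (z == y)) <=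
         \sum_z (v z - w z + (z == cross V1 y x)).
    rewrite !big_split /= !cnt leq_add2r addn1 => lt.
    by apply: (leq_trans lt); rewrite ltnS in le_n.
  rewrite leq_sum // => z _; have := Ev z; rewrite z0E.
  have xz0 : x != z0 by apply: contraTneq wx => ->; rewrite -leqNgt ltnW.
  have yz0 : y != z0 by apply: contraTneq wy => ->; rewrite -leqNgt ltnW.
  case: (eqVneq z x) => [->|_]; first by rewrite (negPf xy) (negPf xz0); lia.
  case: (eqVneq z y) => [->|_]; first by rewrite (negPf yz0); lia.
  by case: (eqVneq z z0) => [->|_]; lia.
- rewrite -vw1; apply: (exchanged_inj (marginal_exchanged (W := V1) Ev)).
  by rewrite !r1; exact: exchanged_refl.
- rewrite -vw2; apply: (exchanged_inj (marginal_exchanged (W := V2) Ev)).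
  by rewrite r2 z0E r20; exact: exchanged_swap.
Qed.

End Reducible.

Theorem lemma4p4 (V : finType) (e : rel V) (d : V -> nat) (V1 V2 : {set V})
  (e_sym : symmetric e) (e_irr : irreflexive e)
  (d_ge2 : forall v : V, 2 <= d v)
  (G_red : reducible_into e V1 V2)
  (pm1 : positive_margins (induced e (W := V1)) (restr_card d (W := V1)))
  (pm2 : positive_margins (induced e (W := V2)) (restr_card d (W := V2))) :
  positive_margins e d.
Proof.
have d_gt0 i : 0 < d i by exact: ltnW (d_ge2 i).
move=> u u_gt0 v w uv uw.
have fib W t := @in_fiber_marginal _ e _ d_gt0 W u t.
have := pm1 _ (positive_marginal d_gt0 u_gt0) _ _ (fib _ _ uv) (fib _ _ uw).
case/(joined_lift e_sym G_red) => v1 [vv1 v1w1 v1v2].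
have := pm2 _ (positive_marginal d_gt0 u_gt0) _ _ (fib _ _ uv) (fib _ _ uw).
(* The first lift kept the [V2]-marginal, so the path for the second subgraph can start at [v1]; its
   lift keeps the [V1]-marginal, already that of [w]. *)
rewrite -v1v2 => /(joined_lift e_sym (reducible_into_sym G_red)).
case=> v2 [v12 v2w2 v2v1]; rewrite v1w1 in v2v1.
apply: joined_trans vv1 (joined_trans v12 _).
exact: joined_same_marginals G_red _ _ _ _.
Qed.
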